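(* Let $0\le\tau\le\varepsilon$, $\lambda:=\tau/\varepsilon$, and let $u_n\in\mathcal V_{[0,1]}$. (1) For $u_{n+1}\in\mathcal V$: there exists $\beta_{n+1}\in\mathcal B(u_{n+1})$ such that $(u_{n+1},\beta_{n+1})$ solves the semi-discrete scheme $$(1-\lambda)u_{n+1}-e^{-\tau\Delta}u_n+\tfrac\lambda2\mathbf 1=\lambda\beta_{n+1}$$ if and only if $$u_{n+1}\in\operatorname*{argmin}_{u\in\mathcal V_{[0,1]}}\ \lambda\langle u,\mathbf 1-u\rangle_{\mathcal V}+\left\|u-e^{-\tau\Delta}u_n\right\|_{\mathcal V}^2.\qquad(\ast)$$ (2) If $\tau=\varepsilon$, then the variational problem $(\ast)$ is equivalent to the minimisation problem defining the MBO updates, $$u_{n+1}\in\operatorname*{argmin}_{u\in\mathcal V_{[0,1]}}\ \frac1{2\tau}\langle\mathbf 1-u,u\rangle_{\mathcal V}+\frac{\|u-e^{-\tau\Delta}u_n\|_{\mathcal V}^2}{2\tau},$$ so in this case the semi-discrete scheme is identical to the MBO scheme. (3) If $\tau<\varepsilon$, then $(\ast)$ has a unique solution, given for each $i\in V$ by $$(u_{n+1})_i=\begin{cases}0,&\text{if }(e^{-\tau\Delta}u_n)_i<\frac12\lambda,\\[2pt]\frac12+\frac{(e^{-\tau\Delta}u_n)_i-1/2}{1-\lambda},&\text{if }\frac12\lambda\le(e^{-\tau\Delta}u_n)_i<1-\frac12\lambda,\\[2pt]1,&\text{if }(e^{-\tau\Delta}u_n)_i\ge1-\frac12\lambda,\end{cases}$$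 with (for $\tau>0$) corresponding $\beta_{n+1}$ term in the semi-discrete scheme $$(\beta_{n+1})_i=\begin{cases}\frac12-\lambda^{-1}(e^{-\tau\Delta}u_n)_i,&\text{if }(e^{-\tau\Delta}u_n)_i<\frac12\lambda,\\[2pt]0,&\text{if }\frac12\lambda\le(e^{-\tau\Delta}u_n)_i<1-\frac12\lambda,\\[2pt]-\frac12+\lambda^{-1}\left(1-(e^{-\tau\Delta}u_n)_i\right),&\text{if }(e^{-\tau\Delta}u_n)_i\ge1-\frac12\lambda.\end{cases}$$
   Context: Let $G=(V,E)$ be a finite, undirected, simple, connected graph with symmetric weights $\omega_{ij}=\omega_{ji}$, $\omega_{ij}>0$ for $ij\in E$ and $\omega_{ij}=0$ for $ij\notin E$. Let $d_i=\sum_{j}\omega_{ij}>0$ be the degree of $i\in V$. Fix $r\in[0,1]$ and $\varepsilon>0$. Let $\mathcal V=\{u:V\to\mathbb R\}$ and, for $X\subseteq\mathbb R$, $\mathcal V_X=\{u:V\to X\}$; $\mathcal V$ carries the inner product $\langle u,v\rangle_{\mathcal V}=\sum_{i\in V}u_iv_id_i^r$ with norm $\|\cdot\|_{\mathcal V}$. $\mathbf 1\in\mathcal V$ is the constant function $1$. The graph Laplacian is $(\Delta u)_i=d_i^{-r}\sum_{j\in V}\omega_{ij}(u_i-u_j)$, and $e^{-t\Delta}=\sum_{n\ge0}\frac{(-1)^nt^n}{n!}\Delta^n$. For $u\in\mathcal V$: if $u\in\mathcal V_{[0,1]}$ then $\mathcal B(u)$ is the set of $\alpha\in\mathcal V$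 such that for each $i\in V$: $\alpha_i\ge0$ if $u_i=0$, $\alpha_i=0$ if $0<u_i<1$, and $\alpha_i\le0$ if $u_i=1$; if $u\notin\mathcal V_{[0,1]}$ then $\mathcal B(u)=\emptyset$. The graph MBO scheme diffuses $u_n$ for time $\tau$ and thresholds at $1/2$; it is expressed variationally by $u_{n+1}\in\operatorname{argmin}_{u\in\mathcal V_{[0,1]}}\langle\mathbf 1-2e^{-\tau\Delta}u_n,u\rangle_{\mathcal V}$, or by the equivalent functional displayed in (2). Two functionals $f,g$ are called equivalent if $g=af+b$ with constants $a>0$, $b$ independent of the argument (so they have the same minimisers). *)

(* Defs.v *)
From HB Require Import structures.
From mathcomp Require Import all_boot all_order all_algebra.
From mathcomp Require Import all_classical all_reals all_analysis.

Set Implicit Arguments.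
Unset Strict Implicit.
Unset Printing Implicit Defensive.
Import Order.TTheory GRing.Theory Num.Theory.
Import numFieldNormedType.Exports.
Local Open Scope classical_set_scope.
Local Open Scope ring_scope.

Record wgraph (R : realType) := WGraph {
  vertex :> finType;
  edge : rel vertex;
  weight : vertex -> vertex -> R;
  vertex_gt0 : (0 < #|vertex|)%N;
  edge_sym : symmetric edge;
  edge_irr : irreflexive edge;
  edge_connected : forall i j, connect edge i j;
  weight_sym : forall i j, weight i j = weight j i;
  weight_gt0 : forall i j, edge i j -> 0 < weight i j;
  weight_eq0 : forall i j, ~~ edge i j -> weight i j = 0;
  (* rules out the graph with a single vertex *)
  degree_gt0 : forall i, 0 < \sum_j weight i j
}.

Section Definitions.
Context {R : realType} {G : wgraph R}.
Implicit Types (r t lam : R) (u v w : {ffun G -> R}) (i : G).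

Definition degree i : R := \sum_j weight i j.

Definition nodefun_in (X : set R) : set {ffun G -> R} :=
  [set u | forall i, X (u i)].

Definition one : {ffun G -> R} := [ffun=> 1].

Definition vdot r u v : R := \sum_i u i * v i * degree i `^ r.

Definition vnorm r u : R := Num.sqrt (vdot r u u).

Definition laplacian r u : {ffun G -> R} :=
  [ffun i => degree i `^ (- r) * \sum_j weight i j * (u i - u j)].

Definition diffusion_term r t u i : R^nat :=
  fun n => (-1) ^+ n * t ^+ n / n`!%:R * iter n (laplacian r) u i.

(* The operator [e^{-t Delta}]; the power series is summed vertex by vertex,
   see [is_cvg_diffusion] for its convergence. *)
Definition diffusion r t u : {ffun G -> R} :=
  [ffun i => limn (series (diffusion_term r t u i))].

Definition obstacle_subdiff u : set {ffun G -> R} :=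
  [set alpha | nodefun_in `[0, 1] u /\
     forall i, [/\ u i = 0 -> 0 <= alpha i,
                   0 < u i < 1 -> alpha i = 0
                 & u i = 1 -> alpha i <= 0]].

Definition argmin (T : Type) (A : set T) (f : T -> R) : set T :=
  [set x | A x /\ forall y, A y -> f x <= f y].

Definition equivalent_functionals (T : Type) (f g : T -> R) : Prop :=
  exists a b : R, 0 < a /\ forall x, g x = a * f x + b.

(* [beta] solves, together with [u], one step of the semi-discrete scheme
   started from [u0]. *)
Definition semidiscrete_step r tau lam u0 u (beta : {ffun G -> R}) : Prop :=
  (1 - lam) *: u - diffusion r tau u0 + (lam / 2) *: one = lam *: beta.

Definition semidiscrete_functional r tau lam u0 u : R :=
  lam * vdot r u (one - u) + vnorm r (u - diffusion r tau u0) ^+ 2.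

Definition mbo_functional r tau u0 u : R :=
  1 / (2 * tau) * vdot r (one - u) u
  + vnorm r (u - diffusion r tau u0) ^+ 2 / (2 * tau).

Definition mbo_linear_functional r tau u0 u : R :=
  vdot r (one - 2 *: diffusion r tau u0) u.

(* Variational form of "diffuse, then threshold at 1/2": a vertex where the
   diffused value is exactly 1/2 may be given any value in [0, 1]. *)
Definition mbo_update r tau u0 : set {ffun G -> R} :=
  argmin (nodefun_in `[0, 1]) (mbo_linear_functional r tau u0).

Definition relaxed_threshold lam w : {ffun G -> R} :=
  [ffun i => if w i < lam / 2 then 0
             else if w i < 1 - lam / 2 then 1 / 2 + (w i - 1 / 2) / (1 - lam)
             else 1].

Definition relaxed_multiplier lam w : {ffun G -> R} :=
  [ffun i => if w i < lam / 2 then 1 / 2 - lam^-1 * w i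
             else if w i < 1 - lam / 2 then 0
             else - (1 / 2) + lam^-1 * (1 - w i)].

Lemma laplacian_bound r :
  exists2 C, 0 <= C & forall u (M : R), (forall i, `|u i| <= M) ->
    forall i, `|laplacian r u i| <= C * M.
Proof.
pose c i : R := `|degree i `^ (- r)| * \sum_j `|weight i j| * 2.
have c0 i : 0 <= c i by apply: mulr_ge0 => //; apply: sumr_ge0 => j _; rewrite mulr_ge0.
exists (\sum_i c i) => [|u M uM i]; first exact: sumr_ge0.
have M0 : 0 <= M by apply: le_trans (uM i).
apply: (@le_trans _ _ (c i * M)); last first.
  apply: ler_wpM2r => //; rewrite (bigD1 i) //= lerDl.
  exact: sumr_ge0.
rewrite ffunE normrM -mulrA ler_wpM2l// mulr_suml.
apply: le_trans (ler_norm_sum _ _ _) _; apply: ler_sum => j _.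
rewrite normrM -mulrA ler_wpM2l// (le_trans (ler_normB _ _))// mulr_natl mulr2n.
exact: lerD.
Qed.

Lemma is_cvg_diffusion r t u i : cvgn (series (diffusion_term r t u i)).
Proof.
have [C C0 HC] := laplacian_bound r.
pose M := \sum_j `|u j|.
have HM n : forall j, `|iter n (laplacian r) u j| <= C ^+ n * M.
  elim: n => [j|n IHn j] /=; last by rewrite exprS -mulrA; apply: HC.
  by rewrite expr0 mul1r /M (bigD1 j) //= lerDl sumr_ge0.
apply: normed_cvg.
apply: (@series_le_cvg _ _ (fun n => M *: exp_coeff (`|t| * C) n)).
- by move=> n /=.
- move=> n; rewrite /exp_coeff /=; apply: mulr_ge0; first exact: sumr_ge0.
  by rewrite divr_ge0// exprn_ge0// mulr_ge0.
- move=> n; rewrite /diffusion_term /exp_coeff /= !normrM normrX normrN1 expr1n.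
  rewrite mul1r normrX normfV normr_nat exprMn.
  apply: le_trans (ler_wpM2l _ (HM n i)) _; first by rewrite divr_ge0// exprn_ge0.
  by rewrite le_eqVlt; apply/orP; left; apply/eqP; rewrite /GRing.scale /=
    mulrC -!mulrA mulrCA; congr (_ * _); rewrite mulrCA; congr (_ * _); rewrite mulrC.
- by apply: is_cvg_seriesZ; exact: is_cvg_series_exp_coeff.
Qed.

End Definitions.

(* Main.v *)
Require Import Defs.
From mathcomp Require Import all_boot all_order all_algebra.
From mathcomp Require Import all_classical all_reals all_analysis.
From mathcomp Require Import ring lra.

Import Order.TTheory GRing.Theory Num.Theory.
Import numFieldNormedType.Exports.
Local Open Scope classical_set_scope.
Local Open Scope ring_scope.

(** The functional of the variational problem is a sum over the vertices: with
    [w] the diffused state, it equals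
      [\sum_i (lam * u i * (1 - u i) + (u i - w i) ^+ 2) * degree i `^ r].
    The weights [degree i `^ r] are positive and the box constraint acts on each
    vertex separately, so [u] is a minimiser exactly when every [u i] minimises
    its own quadratic on [[0, 1]] ([argmin_sumP]).  That quadratic has leading
    coefficient [1 - lam >= 0], hence is convex, and half its derivative is
    [(1 - lam) * x - w i + lam / 2], which is the left-hand side of the
    semi-discrete scheme at [i].  For a convex function on an interval, being a
    minimiser means that the derivative [g] satisfies [g * (y - x) >= 0] for all
    admissible [y] ([node_argminP]); and the same variational inequality, with
    [beta i] in place of [g], characterises the obstacle subdifferential
    ([obstacle_subdiffP]).  Since the scheme says [g = lam * beta i], the two
    conditions agree whenever [lam > 0].  For [lam = 0] the scheme forces
    [u = w], and the variational problem is the projection of [w] on the box;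
    they agree because diffusion for time [0] is the identity, so that
    [w = u0] already lies in the box ([diffusion0]).

    For [lam = 1] the quadratic degenerates to [(1 - 2 w i) x + w i ^+ 2], which
    gives the thresholding functional of the MBO scheme up to a constant.  For
    [lam < 1] it is strictly convex, so the minimiser is unique, and it suffices
    to check the variational inequality for the piecewise affine formula. *)

(** * The quadratic problem at one vertex *)

Section Node.
Context {R : realType}.
Implicit Types (lam a b x y : R).

Definition node_cost lam a x : R := lam * (x * (1 - x)) + (x - a) ^+ 2.

(** Half the derivative of [node_cost lam a] at [x]. *)
Definition node_slope lam a x : R := (1 - lam) * x - a + lam / 2.

(** The scalar instances of [relaxed_threshold] and [relaxed_multiplier]. *)
Definition node_threshold lam a : R :=
  if a < lam / 2 then 0
  else if a < 1 - lam / 2 then 1 / 2 + (a - 1 / 2) / (1 - lam) else 1.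

Definition node_multiplier lam a : R :=
  if a < lam / 2 then 1 / 2 - lam^-1 * a
  else if a < 1 - lam / 2 then 0
  else - (1 / 2) + lam^-1 * (1 - a).

(** The variational inequality saying that [- b] lies in the normal cone of
    [[0, 1]] at [x]. *)
Definition inward b x : Prop := forall y, 0 <= y <= 1 -> 0 <= b * (y - x).

Lemma inwardP b x : 0 <= x <= 1 ->
  inward b x <->
  [/\ x = 0 -> 0 <= b, 0 < x < 1 -> b = 0 & x = 1 -> b <= 0].
Proof.
move=> /andP[x0 x1]; split=> [bx|[b0 bI b1] y /andP[y0 y1]].
  have h0 : 0 <= b * (0 - x) by apply: bx; lra.
  have h1 : 0 <= b * (1 - x) by apply: bx; lra.
  split=> [xE|/andP[xgt0 xlt1]|xE]; [by move: h1; rewrite xE; lra| |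
    by move: h0; rewrite xE; lra].
  apply/eqP; rewrite eq_le; apply/andP; split.
    by rewrite -(pmulr_lle0 _ xgt0) mulrC; lra.
  by rewrite -(pmulr_lge0 _ (_ : 0 < 1 - x)) ?subr_gt0// mulrC; lra.
have [xE|xN0] := eqVneq x 0; first by rewrite xE subr0 mulr_ge0 ?b0.
have [xE|xN1] := eqVneq x 1.
  by apply: mulr_le0; [exact: b1|rewrite xE subr_le0].
by rewrite bI ?mul0r// !lt_def xN0 x0 eq_sym xN1 x1.
Qed.

Lemma inward_pmull lam b x : 0 < lam -> inward (lam * b) x <-> inward b x.
Proof.
by move=> lam0; split=> bx y /bx; rewrite -(mulrA lam) (pmulr_rge0 _ lam0).
Qed.

(** The second-order Taylor expansion, exact for a quadratic. *)
Lemma node_cost_expand lam a x y :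
  node_cost lam a y =
  node_cost lam a x + 2 * (node_slope lam a x * (y - x))
  + (1 - lam) * (y - x) ^+ 2.
Proof. by rewrite /node_cost /node_slope; field. Qed.

(** First-order optimality is necessary because the quadratic term of the
    expansion is negligible along short segments, and sufficient because that
    term is nonnegative when [lam <= 1]. *)
Lemma node_argminP lam a x : 0 <= lam <= 1 -> 0 <= x <= 1 ->
  (forall y, 0 <= y <= 1 -> node_cost lam a x <= node_cost lam a y) <->
  inward (node_slope lam a x) x.
Proof.
move=> /andP[lam0 lam1] /andP[x0 x1]; split=> [xmin y /andP[y0 y1]|xin y y01].
  rewrite leNgt; apply/negP => s_lt0.
  set s := node_slope lam a x * (y - x) in s_lt0 *.
  (* with this step length the quadratic term is at most [- t * s], half the
     linear decrease [- 2 * t * s] *)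
  pose t := - s / (1 - s).
  have t0 : 0 < t by rewrite divr_gt0; lra.
  have tE : t * (1 - s) = - s by rewrite /t divfK//; lra.
  have t1 : t <= 1 by rewrite ler_pdivrMr; lra.
  have ts : t <= - s by nra.
  have sq1 : (1 - lam) * (y - x) ^+ 2 <= 1.
    have h : (y - x) ^+ 2 <= 1 by nra.
    have h' : 0 <= (y - x) ^+ 2 by exact: sqr_ge0.
    by nra.
  have z01 : 0 <= x + t * (y - x) <= 1 by apply/andP; split; nra.
  have := xmin _ z01; rewrite (node_cost_expand _ _ x (x + _)).
  have -> : x + t * (y - x) - x = t * (y - x) by ring.
  rewrite (mulrCA _ t) -/s exprMn (mulrCA (1 - lam)).
  set q := (1 - lam) * (y - x) ^+ 2 in sq1 *.
  have tq : t ^+ 2 * q <= t * - s.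
    rewrite expr2 -mulrA ler_pM2l//; apply: le_trans ts.
    by rewrite -[leRHS]mulr1 ler_pM2l.
  have : t * s < 0 by rewrite pmulr_rlt0.
  by lra.
rewrite (node_cost_expand _ _ x y).
have := xin _ y01; have : 0 <= (1 - lam) * (y - x) ^+ 2.
  by rewrite mulr_ge0 ?sqr_ge0 ?subr_ge0.
by lra.
Qed.

(** For [lam < 1] the slope is strictly increasing, so the variational
    inequalities at two solutions, each tested with the other one, are only
    compatible if the solutions coincide. *)
Lemma inward_slope_inj lam a x y : lam < 1 -> 0 <= x <= 1 -> 0 <= y <= 1 ->
  inward (node_slope lam a x) x -> inward (node_slope lam a y) y -> x = y.
Proof.
move=> lam1 x01 y01 /(_ _ y01) hx /(_ _ x01) hy.
have h : (1 - lam) * (x - y) ^+ 2 <= 0.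
  by move: hx hy; rewrite /node_slope; lra.
apply/eqP; rewrite -subr_eq0 -sqrf_eq0 eq_le sqr_ge0 andbT.
by rewrite -(pmulr_rle0 _ (_ : 0 < 1 - lam)) ?subr_gt0.
Qed.

Lemma node_threshold01 lam a : lam < 1 -> 0 <= node_threshold lam a <= 1.
Proof.
move=> lam1; rewrite /node_threshold; case: ltP => [_|la]; first by lra.
case: ltP => [al|_]; last by lra.
have h : 0 < 1 - lam by lra.
have -> : 1 / 2 + (a - 1 / 2) / (1 - lam) = (a - lam / 2) / (1 - lam).
  by field; lra.
by rewrite divr_ge0 ?ler_pdivrMr//=; lra.
Qed.

Lemma node_slope_threshold lam a : lam < 1 ->
  node_slope lam a (node_threshold lam a) =
  if a < lam / 2 then lam / 2 - a
  else if a < 1 - lam / 2 then 0 else 1 - lam / 2 - a.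
Proof.
move=> lam1; rewrite /node_slope /node_threshold.
case: ifP => _; first by ring.
by case: ifP => _; [field; lra|field].
Qed.

Lemma inward_threshold lam a : lam < 1 ->
  inward (node_slope lam a (node_threshold lam a)) (node_threshold lam a).
Proof.
move=> lam1 y /andP[y0 y1]; rewrite node_slope_threshold// /node_threshold.
case: ltP => [la|la]; first by nra.
by case: ltP => [al|al]; [rewrite mul0r|nra].
Qed.

Lemma node_slope_multiplier lam a : 0 < lam < 1 ->
  node_slope lam a (node_threshold lam a) = lam * node_multiplier lam a.
Proof.
move=> /andP[lam0 lam1]; rewrite node_slope_threshold// /node_multiplier.
case: ifP => _; first by field; lra.
by case: ifP => _; [rewrite mulr0|field; lra].
Qed.

End Node.

(** * From vertices to the graph *)

Section Graph.
Context {R : realType} {G : wgraph R}.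
Implicit Types (r tau lam : R) (u v : {ffun G -> R}).

(** Only the term of order [0] of the exponential series survives. *)
Lemma diffusion0 r u : diffusion r 0 u = u.
Proof.
apply/ffunP => i; rewrite ffunE; apply: lim_near_cst; first exact: Rhausdorff.
exists 1%N => // -[//|n] _.
rewrite /series /= big_nat_recl//= big1_seq => [|k _].
  by rewrite addr0 /diffusion_term /= !expr0 fact0 divr1 !mul1r.
by rewrite /diffusion_term expr0n /= mulr0 !mul0r.
Qed.

Lemma vdot_vnorm r u : vnorm r u ^+ 2 = vdot r u u.
Proof.
rewrite sqr_sqrtr//; apply: sumr_ge0 => i _.
by rewrite mulr_ge0 ?powR_ge0// -expr2 sqr_ge0.
Qed.

Lemma semidiscrete_functionalE r tau lam u0 u :
  semidiscrete_functional r tau lam u0 u =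
  \sum_i node_cost lam (diffusion r tau u0 i) (u i) * degree i `^ r.
Proof.
rewrite /semidiscrete_functional vdot_vnorm /vdot mulr_sumr -big_split /=.
by apply: eq_bigr => i _; rewrite /node_cost !ffunE; ring.
Qed.

(** A change at a single vertex affects only the summand of that vertex, so
    global minimality passes to each summand. *)
Lemma argmin_sumP (X : set R) (f : G -> R -> R) (m : G -> R) u :
  (forall i, 0 < m i) ->
  argmin (nodefun_in X) (fun v => \sum_i f i (v i) * m i) u <->
  nodefun_in X u /\ forall i y, X y -> f i (u i) <= f i y.
Proof.
move=> m0; split=> -[uX umin]; split=> //.
  move=> i y Xy; pose v : {ffun G -> R} := [ffun j => if j == i then y else u j].
  have vX : nodefun_in X v by move=> j; rewrite ffunE; case: ifP.
  have := umin _ vX; rewrite (bigD1 i)//= [leRHS](bigD1 i)//= ffunE eqxx.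
  rewrite (eq_bigr (fun j => f j (v j) * m j)) => [|j /negPf ji].
    by rewrite lerD2r ler_pM2r.
  by rewrite ffunE ji.
by move=> v vX; apply: ler_sum => i _; rewrite ler_pM2r// umin.
Qed.

Lemma nodefun_in01 u : nodefun_in `[0, 1] u <-> forall i, 0 <= u i <= 1.
Proof. by split=> u01 i; have := u01 i; rewrite /= in_itv. Qed.

Lemma argmin_semidiscreteP r tau lam u0 u : 0 <= lam <= 1 ->
  argmin (nodefun_in `[0, 1]) (semidiscrete_functional r tau lam u0) u <->
  nodefun_in `[0, 1] u /\
  forall i, inward (node_slope lam (diffusion r tau u0 i) (u i)) (u i).
Proof.
move=> lam01.
rewrite (_ : semidiscrete_functional _ _ _ _ = fun v =>
  \sum_i node_cost lam (diffusion r tau u0 i) (v i) * degree i `^ r); last first.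
  by apply/funext => v; exact: semidiscrete_functionalE.
rewrite (@argmin_sumP _ (fun i => node_cost lam (diffusion r tau u0 i))).
  split=> -[u01 umin]; split=> // i; have ui := (nodefun_in01 u).1 u01 i.
    by apply/node_argminP => // y y01; apply: umin; rewrite /= in_itv.
  by move=> y; rewrite /= in_itv /=; move: y; apply/node_argminP.
by move=> i; apply: powR_gt0; exact: degree_gt0.
Qed.

Lemma obstacle_subdiffP u (alpha : {ffun G -> R}) :
  obstacle_subdiff u alpha <->
  nodefun_in `[0, 1] u /\ forall i, inward (alpha i) (u i).
Proof.
by split=> -[u01 h]; split=> // i; have ui := (nodefun_in01 u).1 u01 i;
  apply/inwardP.
Qed.

Lemma semidiscrete_stepP r tau lam u0 u (beta : {ffun G -> R}) :
  semidiscrete_step r tau lam u0 u beta <->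
  forall i, node_slope lam (diffusion r tau u0 i) (u i) = lam * beta i.
Proof.
rewrite /semidiscrete_step /node_slope; split=> [/ffunP h i|h].
  by have := h i; rewrite !ffunE /GRing.scale /= mulr1.
by apply/ffunP => i; rewrite !ffunE /GRing.scale /= mulr1 -h ffunE.
Qed.

Lemma argmin_equivalent (T : Type) (A : set T) (f g : T -> R) :
  equivalent_functionals f g -> argmin A f = argmin A g.
Proof.
move=> [a [b [a0 gE]]]; apply/seteqP.
by split=> x [Ax xmin]; split=> // y /xmin; rewrite !gE lerD2r ler_pM2l.
Qed.

(** The hypothesis on [lam = 0] covers the case in which the scheme puts no
    condition on [beta]: it then reads [u = w], whereas the minimiser is the
    projection of [w] on the box. *)
Lemma semidiscrete_step_argmin r tau lam u0 u : 0 <= lam <= 1 ->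
  (lam = 0 -> nodefun_in `[0, 1] (diffusion r tau u0)) ->
  (exists2 beta, obstacle_subdiff u beta
               & semidiscrete_step r tau lam u0 u beta)
  <-> argmin (nodefun_in `[0, 1]) (semidiscrete_functional r tau lam u0) u.
Proof.
move=> lam01 w01; have /andP[lam_ge0 _] := lam01.
rewrite argmin_semidiscreteP//; split.
  move=> [beta /obstacle_subdiffP[u01 ub] /semidiscrete_stepP step].
  split=> // i; rewrite step; have [->|lam_neq0] := eqVneq lam 0.
    by move=> y _; rewrite !mul0r.
  by apply/inward_pmull; rewrite // lt_def lam_neq0.
move=> [u01 uin]; have [lamE|lam_neq0] := eqVneq lam 0.
  exists 0; first by apply/obstacle_subdiffP; split=> // i y _;
    rewrite ffunE mul0r.
  apply/semidiscrete_stepP => i; rewrite lamE mul0r.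
  (* testing with [y = w i] gives [- (u i - w i) ^+ 2 >= 0] *)
  have := uin i _ ((nodefun_in01 _).1 (w01 lamE) i).
  rewrite lamE /node_slope subr0 mul1r mul0r addr0 => h.
  apply/eqP; rewrite -sqrf_eq0 eq_le sqr_ge0 andbT expr2.
  by lra.
have lam0 : 0 < lam by rewrite lt_def lam_neq0.
pose beta : {ffun G -> R} :=
  [ffun i => lam^-1 * node_slope lam (diffusion r tau u0 i) (u i)].
have lamb i : lam * beta i = node_slope lam (diffusion r tau u0 i) (u i).
  by rewrite ffunE mulVKf.
exists beta; last by apply/semidiscrete_stepP => i; rewrite lamb.
by apply/obstacle_subdiffP; split=> // i; rewrite -(inward_pmull _ _ _ lam0) lamb.
Qed.

Lemma equivalent_mbo r tau u0 : 0 < tau ->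
  equivalent_functionals (semidiscrete_functional r tau 1 u0)
                         (@mbo_functional R G r tau u0).
Proof.
move=> tau0; exists (2 * tau)^-1, 0; split=> [|u].
  by rewrite invr_gt0 mulr_gt0.
rewrite /mbo_functional /semidiscrete_functional.
have -> : vdot r (Defs.one - u) u = vdot r u (Defs.one - u).
  by apply: eq_bigr => i _; rewrite (mulrC (u i)).
by field; lra.
Qed.

(** The terms [- u i ^+ 2] and [u i ^+ 2] cancel when [lam = 1], leaving the
    linear functional and the constant [vdot r w w]. *)
Lemma equivalent_mbo_linear r tau u0 :
  equivalent_functionals (semidiscrete_functional r tau 1 u0)
                         (@mbo_linear_functional R G r tau u0).
Proof.
pose w := diffusion r tau u0.
exists 1, (- vdot r w w); split=> // u.
rewrite semidiscrete_functionalE mul1r /mbo_linear_functional /vdot -sumrB.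
apply: eq_bigr => i _.
by rewrite /node_cost -/w !ffunE /GRing.scale /=; ring.
Qed.

Lemma argmin_relaxed_threshold r tau lam u0 : 0 <= lam < 1 ->
  argmin (nodefun_in `[0, 1]) (@semidiscrete_functional R G r tau lam u0) =
  [set relaxed_threshold lam (diffusion r tau u0)].
Proof.
move=> /andP[lam0 lam1]; set w := diffusion r tau u0.
have lam01 : 0 <= lam <= 1 by rewrite lam0 ltW.
have thrE i : relaxed_threshold lam w i = node_threshold lam (w i).
  by rewrite ffunE.
apply/seteqP; split=> u /=.
  move=> /(argmin_semidiscreteP _ _ _ _ _ lam01)[/nodefun_in01 u01 uin].
  apply/ffunP => i; rewrite thrE.
  apply: (@inward_slope_inj _ lam (w i)) => //; first exact: node_threshold01.
  exact: inward_threshold.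
move=> ->; apply/argmin_semidiscreteP => //; split=> [|i].
  by apply/nodefun_in01 => i; rewrite thrE node_threshold01.
by rewrite thrE; exact: inward_threshold.
Qed.

(** Given the state, the scheme determines [lam *: beta], hence [beta]. *)
Lemma relaxed_multiplierP r tau lam u0 (beta : {ffun G -> R}) : 0 < lam < 1 ->
  let u := relaxed_threshold lam (diffusion r tau u0) in
  (obstacle_subdiff u beta /\ semidiscrete_step r tau lam u0 u beta) <->
  beta = relaxed_multiplier lam (diffusion r tau u0).
Proof.
move=> lam01 /=; have /andP[lam0 lam1] := lam01.
set w := diffusion r tau u0.
have thrE i : relaxed_threshold lam w i = node_threshold lam (w i).
  by rewrite ffunE.
have mulE i : relaxed_multiplier lam w i = node_multiplier lam (w i).
  by rewrite ffunE.
have step : semidiscrete_step r tau lam u0 (relaxed_threshold lam w)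
              (relaxed_multiplier lam w).
  by apply/semidiscrete_stepP => i; rewrite mulE thrE node_slope_multiplier.
split=> [[_]|->].
  rewrite /semidiscrete_step step => /(congr1 (fun v => lam^-1 *: v)).
  by rewrite !scalerA mulVf ?gt_eqF// !scale1r.
split=> //; apply/obstacle_subdiffP; split=> [|i].
  by apply/nodefun_in01 => i; rewrite thrE node_threshold01.
rewrite -(inward_pmull _ _ _ lam0) mulE -node_slope_multiplier// thrE.
exact: inward_threshold.
Qed.

End Graph.

Theorem theorem4p2 (R : realType) (G : wgraph R) (r eps tau : R)
    (hr : 0 <= r <= 1) (heps : 0 < eps) (htau : 0 <= tau <= eps)
    (u0 : {ffun G -> R}) (hu0 : nodefun_in `[0, 1] u0) :
  let lam := tau / eps in
  let w := diffusion r tau u0 in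
  let F := semidiscrete_functional r tau lam u0 in
  [/\ (* the scheme and its variational form *)
      forall u : {ffun G -> R},
        (exists2 beta, obstacle_subdiff u beta
                     & semidiscrete_step r tau lam u0 u beta)
        <-> argmin (nodefun_in `[0, 1]) F u,
      (* the MBO case *)
      tau = eps ->
        [/\ equivalent_functionals F (mbo_functional r tau u0),
            equivalent_functionals F (mbo_linear_functional r tau u0)
          & forall u : {ffun G -> R},
              (exists2 beta, obstacle_subdiff u beta
                           & semidiscrete_step r tau lam u0 u beta)
              <-> mbo_update r tau u0 u]
      (* the unique solution and its multiplier *)
    & tau < eps ->
        argmin (nodefun_in `[0, 1]) F = [set relaxed_threshold lam w] /\
        (0 < tau ->
           forall beta : {ffun G -> R},
             (obstacle_subdiff (relaxed_threshold lam w) beta /\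
              semidiscrete_step r tau lam u0 (relaxed_threshold lam w) beta)
             <-> beta = relaxed_multiplier lam w)].
Proof.
move=> lam w F; have /andP[tau0 tau_eps] := htau.
have lam01 : 0 <= lam <= 1.
  by rewrite /lam ler_pdivrMr// mul1r tau_eps andbT divr_ge0// ltW.
have part1 u : (exists2 beta, obstacle_subdiff u beta
                            & semidiscrete_step r tau lam u0 u beta)
               <-> argmin (nodefun_in `[0, 1]) F u.
  apply: semidiscrete_step_argmin => // /eqP.
  by rewrite mulf_eq0 invr_eq0 (gt_eqF heps) orbF => /eqP ->; rewrite diffusion0.
split=> // [tauE|tau_lt].
  have lamE : lam = 1 by rewrite /lam tauE divff ?gt_eqF.
  have Flin : equivalent_functionals F (mbo_linear_functional r tau u0).
    by rewrite /F lamE; exact: equivalent_mbo_linear.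
  split=> // [|u].
    by rewrite /F lamE; apply: equivalent_mbo; rewrite tauE.
  by rewrite part1 (argmin_equivalent _ _ _ _ Flin).
have lam1 : lam < 1 by rewrite /lam ltr_pdivrMr// mul1r.
split=> [|tau_gt0 beta].
  by apply: argmin_relaxed_threshold; rewrite lam1; case/andP: lam01 => ->.
by apply: relaxed_multiplierP; rewrite lam1 divr_gt0.
Qed.
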